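(* If $\cot F=q<\infty$ and $$\mathcal{L}(E_1,\dots,E_s;\mathbb{K})=\mathcal{L}_{as(1;q_1,\dots,q_s)}(E_1,\dots,E_s;\mathbb{K}),$$ then, for any Banach spaces $E_{s+1},\dots,E_n$, $$\mathcal{L}(E_1,\dots,E_n;F)=\mathcal{L}_{as(q;q_1,\dots,q_s,1,\dots,1)}(E_1,\dots,E_n;F),$$ where the index $1$ after $q_s$ is repeated $n-s$ times.
   Context: $E_1,\dots,E_n$ and $F$ are Banach spaces over the scalar field $\mathbb{K}$, which is $\mathbb{R}$ or $\mathbb{C}$. $\mathcal{L}(E_1,\dots,E_n;F)$ is the space of bounded $n$-linear mappings $E_1\times\dots\times E_n\to F$. For real $p\ge1$, $l_p(E)$ is the space of sequences $(x_j)$ in $E$ with $\sum_j\|x_j\|^p<\infty$, and $l_p^w(E)$ is the space of sequences $(x_j)$ in $E$ with $(\varphi(x_j))_j\in l_p$ for every bounded linear functional $\varphi$ on $E$. For real numbers $p,q_1,\dots,q_n\ge1$, a mapping $T\in\mathcal{L}(E_1,\dots,E_n;F)$ is absolutely $(p;q_1,\dots,q_n)$-summing if $(T(x_j^{(1)},\dots,x_j^{(n)}))_{j=1}^\infty\in l_p(F)$ whenever $(x_j^{(i)})_{j=1}^\infty\in l_{q_i}^w(E_i)$ for $i=1,\dots,n$; the space of all such mappings is denoted $\mathcal{L}_{as(p;q_1,\dots,q_n)}(E_1,\dots,E_n;F)$. $F$ has cotype $r\in[2,\infty)$ if there is $C\ge0$ such that $(\sum_{j=1}^m\|y_j\|^r)^{1/r}\le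 C(\int_0^1\|\sum_{j=1}^m r_j(t)y_j\|^2dt)^{1/2}$ for all $m$ and $y_1,\dots,y_m\in F$, where $r_j$ are the Rademacher functions. $\cot F$ denotes the infimum of the $r\in[2,\infty)$ such that $F$ has cotype $r$ (and $\infty$ if there is none).
   Formalization: The formal theorem additionally assumes that F has cotype q, i.e. that the infimum cot F = q is attained; without this the claim is false (e.g. an l_2-sum of finite-dimensional l_p spaces with p decreasing to 2 has cot F = 2, but its identity is not (2;1)-summing). *)

(* Defs.v *)
From mathcomp Require Import all_boot all_order all_algebra.
From mathcomp Require Import all_classical all_reals all_analysis.
From mathcomp Require Import complex.
Set Implicit Arguments.
Unset Strict Implicit.
Unset Printing Implicit Defensive.
Import Order.TTheory GRing.Theory Num.Theory.
Import numFieldNormedType.Exports.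
Local Open Scope classical_set_scope.
Local Open Scope ring_scope.

Inductive scalar_kind := RealScalars | ComplexScalars.

Definition scalars (R : realType) (k : scalar_kind) : numFieldType :=
  match k with RealScalars => R | ComplexScalars => complex R end.

(* Norms in a [normedModType K] take their values in [K]; they are read in [R]
   by taking the real part, which loses nothing as they are real. *)
Definition re (R : realType) (k : scalar_kind) : scalars R k -> R :=
  match k with RealScalars => id | ComplexScalars => @complex.Re R end.

Definition rnorm (R : realType) (k : scalar_kind)
  (E : normedModType (scalars R k)) (x : E) : R := re `|x|.

Section summability.
Variables (R : realType) (k : scalar_kind).
Local Notation K := (scalars R k).

Definition lp (E : normedModType K) (p : R) : set (nat -> E) :=
  [set x : nat -> E | (\sum_(0 <= j <oo) (rnorm (x j) `^ p)%:E < +oo)%E].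

Definition bounded_functional (E : normedModType K) : set (E -> K^o) :=
  [set phi : E -> K^o | linear phi /\
    exists M : R, forall x, rnorm (phi x) <= M * rnorm x].

Definition weak_lp (E : normedModType K) (p : R) : set (nat -> E) :=
  [set x : nat -> E |
    forall phi : E -> K^o, bounded_functional phi -> lp p (fun j => phi (x j))].

Section multilinear.
Variables (n : nat) (E : 'I_n -> completeNormedModType K) (F : normedModType K).

(* [dfwith x i u] is the tuple [x] with its [i]-th entry replaced by [u]. *)
Definition multilinear (T : (forall i, E i) -> F) : Prop :=
  forall (x : forall i, E i) (i : 'I_n),
    linear (fun u : E i => T (@dfwith _ E x i u)).

Definition bounded_multilinear : set ((forall i, E i) -> F) :=
  [set T : (forall i, E i) -> F | multilinear T /\
    exists M : R, forall x, rnorm (T x) <= M * \prod_(i < n) rnorm (x i)].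

Definition abs_summing (p : R) (q : 'I_n -> R) : set ((forall i, E i) -> F) :=
  [set T : (forall i, E i) -> F | bounded_multilinear T /\
    forall x : forall i, nat -> E i,
      (forall i, weak_lp (q i) (x i)) -> lp p (fun j => T (fun i => x i j))].

End multilinear.

Section cotype.
Variable F : normedModType K.

(* Values in [int], acting on [F] by [*~]; [j] starts from 1. *)
Definition rademacher (j : nat) (t : R) : int := sgz (sin (2 ^+ j * pi * t)).

Definition has_cotype (r : R) : Prop :=
  exists2 C : R, 0 <= C & forall (m : nat) (y : 'I_m -> F),
    (\sum_(j < m) rnorm (y j) `^ r) `^ r^-1 <=
    C * Num.sqrt (\int[lebesgue_measure]_(t in `[0%R, 1%R])
                    (rnorm (\sum_(j < m) y j *~ rademacher j.+1 t) ^+ 2)).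

Definition cot : \bar R :=
  ereal_inf [set r%:E | r in [set r | 2 <= r /\ has_cotype r]].

End cotype.
End summability.

Arguments bounded_multilinear {R k n} E F.
Arguments abs_summing {R k n} E F p q.

(* [(q_1, ..., q_s, 1, ..., 1)] with [m] trailing ones. *)
Definition pad_ones (R : realType) (s m : nat) (q : 'I_s -> R)
  (i : 'I_(s + m)) : R :=
  match fintype.split i with inl j => q j | inr _ => 1 end.

Arguments pad_ones {R s} m q i.

(* Main.v *)
From HB Require Import structures.
Require Import Defs.
From mathcomp Require Import all_boot all_order all_algebra.
From mathcomp Require Import all_classical all_reals all_analysis.
From mathcomp Require Import complex ring lra zify.
Set Implicit Arguments.
Unset Strict Implicit.
Unset Printing Implicit Defensive.
Import Order.TTheory GRing.Theory Num.Theory.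
Import numFieldNormedType.Exports.
Local Open Scope classical_set_scope.
Local Open Scope ring_scope.

(** Let [T] be a bounded multilinear map into [F], and let [y j] be its value at
    the [j]-th terms of the given weakly summable sequences. The proof shows
    more than required: [y] is weakly summable of exponent one. For such a
    sequence all signed finite sums are bounded ([weak_l1_signed_sums]), hence so
    are the Rademacher averages in the cotype inequality, which then bounds the
    sums of [rnorm (y j) `^ q] ([cotype_weak_l1]).

    Composing [T] with a bounded functional on [F] reduces the weak summability
    of [y] to the absolute summability of [A (x_j)] for a scalar form [A] of
    [s + m] variables ([forms_abs_summing]). If the last [m] variables are kept
    fixed, this is the hypothesis on the [s]-linear forms. The fixed variables
    are then replaced one by one by weakly summable sequences of exponent one.
    Each replacement concerns functionals [b j] on a Banach space such that the
    [b j z] are absolutely summable for every [z], and a weakly summable sequence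
    [x]; the claim is that the [b j (x j)] are absolutely summable
    ([lp1_functionals_weak_l1]). By uniform boundedness the sum of the
    [`|b j z|] is at most a constant times the norm of [z]. One takes for [z] the
    signed sums of [x], which are bounded, and averages over the signs: the
    average of [`|b j z|] is at least [`|b j (x j)|]
    ([diagonal_le_signed_sums]).

    The boundedness of signed sums follows from the uniform boundedness
    principle on the dual space together with the existence of norming
    functionals. Both are proved with real functionals, [F] being seen
    as a real vector space through [real_scalar], so that real and
    complex scalars are treated alike; [extend_real_functional] returns to
    functionals over the scalars of [F]. *)

(** * Real scalars and real-valued norms *)

Section Scalars.
Variables (R : realType) (k : scalar_kind).
Local Notation K := (scalars R k).

Definition real_scalar : R -> K :=
  match k with RealScalars => id | ComplexScalars => real_complex R end.

Lemma re_real_scalar (a : R) : re (real_scalar a) = a.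
Proof. by rewrite /re /real_scalar; case: k. Qed.

Lemma real_scalarD (a b : R) :
  real_scalar (a + b) = real_scalar a + real_scalar b.
Proof. by rewrite /real_scalar; case: k => //=; rewrite rmorphD. Qed.

Lemma real_scalarM (a b : R) :
  real_scalar (a * b) = real_scalar a * real_scalar b.
Proof. by rewrite /real_scalar; case: k => //=; rewrite rmorphM. Qed.

Lemma real_scalar1 : real_scalar 1 = 1.
Proof. by rewrite /real_scalar; case: k => //=. Qed.

Lemma real_scalar0 : real_scalar 0 = 0.
Proof. by rewrite /real_scalar; case: k => //=. Qed.

Lemma ler_real_scalar (a b : R) : (real_scalar a <= real_scalar b) = (a <= b).
Proof. by rewrite /real_scalar; case: k => //=; exact: lecR. Qed.

Lemma ltr_real_scalar (a b : R) : (real_scalar a < real_scalar b) = (a < b).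
Proof. by rewrite /real_scalar; case: k => //=; exact: ltcR. Qed.

Lemma norm_real_scalar (a : R) : `|real_scalar a| = real_scalar `|a|.
Proof.
rewrite /real_scalar; case: k => //=.
by rewrite normc_def /= expr0n addr0 sqrtr_sqr.
Qed.

Lemma real_scalar_re (z : K) : 0 <= z -> z = real_scalar (re z).
Proof.
rewrite /real_scalar /re; case: k z => //= -[a b].
by rewrite lecE /= => /andP[/eqP-> _].
Qed.

Lemma reD (z w : K) : re (z + w) = re z + re w.
Proof. by rewrite /re; case: k z w => //= -[a b] [c d]. Qed.

Lemma reM (a : R) (z : K) : re (real_scalar a * z) = a * re z.
Proof.
by rewrite /re /real_scalar; case: k z => //= -[b c] /=; rewrite mul0r subr0.
Qed.

Lemma norm_re_le (z : K) : `|re z| <= re `|z|.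
Proof.
rewrite /re; case: k z => //= z; rewrite -lecR.
exact: normc_ge_Re.
Qed.

Section Norm.
Variable E : normedModType K.
Implicit Types x y : E.

Lemma norm_rnorm x : `|x| = real_scalar (rnorm x).
Proof. by rewrite -real_scalar_re. Qed.

Lemma rnorm_ge0 x : 0 <= rnorm x.
Proof. by rewrite -ler_real_scalar -norm_rnorm real_scalar0. Qed.

Lemma rnormD x y : rnorm (x + y) <= rnorm x + rnorm y.
Proof. by rewrite -ler_real_scalar real_scalarD -!norm_rnorm ler_normD. Qed.

Lemma rnormN x : rnorm (- x) = rnorm x.
Proof. by rewrite /rnorm normrN. Qed.

Lemma rnormB x y : rnorm (x - y) <= rnorm x + rnorm y.
Proof. by rewrite -(rnormN y); exact: rnormD. Qed.

Lemma rnorm0 : rnorm (0 : E) = 0.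
Proof. by rewrite /rnorm normr0 -real_scalar0 re_real_scalar. Qed.

Lemma rnormZ (a : K) x : rnorm (a *: x) = rnorm (a : K^o) * rnorm x.
Proof.
by rewrite {1}/rnorm normrZ (norm_rnorm x) mulrC reM mulrC.
Qed.

Lemma rnorm_real_scalar (a : R) : rnorm (real_scalar a : K^o) = `|a|.
Proof. by rewrite /rnorm /= norm_real_scalar re_real_scalar. Qed.

End Norm.
End Scalars.

(** * Norming functionals *)

Section HahnBanach.
Variables (R : realType) (k : scalar_kind).
Local Notation K := (scalars R k).
Local Notation rs := (@real_scalar R k).

Definition sublinear (V : lmodType K) (p : V -> R) : Prop :=
  (forall x y, p (x + y) <= p x + p y) /\
  (forall t x, 0 < t -> p (rs t *: x) <= t * p x).

Definition real_linear (V : lmodType K) (u : V -> R) : Prop :=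
  (forall x y, u (x + y) = u x + u y) /\ (forall t x, u (rs t *: x) = t * u x).

Section Sublinear.
Variable V : lmodType K.
Implicit Types (p q : V -> R) (x y v : V).

Lemma sublinearZ p t x : sublinear p -> 0 < t -> p (rs t *: x) = t * p x.
Proof.
move=> [_ hp] t0; apply/eqP; rewrite eq_le hp//=.
have := hp t^-1 (rs t *: x); rewrite invr_gt0 => /(_ t0).
rewrite scalerA -real_scalarM mulVf ?gt_eqF// real_scalar1 scale1r.
by rewrite -(ler_pM2l t0) mulrA divff ?gt_eqF// mul1r.
Qed.

Lemma sublinear0 p : sublinear p -> p 0 = 0.
Proof.
move=> hp; have := @sublinearZ p 2 0 hp (ltr0Sn _ _).
by rewrite scaler0 => h; lra.
Qed.

Lemma sublinear_ge p x : sublinear p -> - p (- x) <= p x.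
Proof.
move=> hp; have := hp.1 x (- x); rewrite subrr (sublinear0 hp) => h; lra.
Qed.

(** Directedness is what makes the infimum subadditive; it holds for chains of
    sublinear functionals and also for the family that defines [tangent],
    whose members are in general not sublinear. *)
Lemma inf_sublinear (I : Type) (i0 : I) (f : I -> V -> R) :
    (forall i j x y, exists l, f l (x + y) <= f i x + f j y) ->
    (forall i t x, 0 < t -> exists l, f l (rs t *: x) <= t * f i x) ->
    (forall x, exists b, forall i, b <= f i x) ->
  let p := fun x => inf (range (f^~ x)) in
  sublinear p /\ forall i x, p x <= f i x.
Proof.
move=> fD fZ fb p.
have lb x : has_lbound (range (f^~ x)).
  by have [b hb] := fb x; exists b => _ [i _ <-].
have inf_family_le i x : p x <= f i x by apply: ge_inf => //; exists i.
have le_inf_family b x : (forall i, b <= f i x) -> b <= p x.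
  move=> hb; apply: lb_le_inf; first by exists (f i0 x), i0.
  by move=> _ [i _ <-].
split=> //; split=> [x y|t x t0].
- rewrite -lerBlDr; apply: (le_inf_family) => i; rewrite lerBlDr -lerBlDl.
  apply: (le_inf_family) => j; rewrite lerBlDl.
  by have [l hl] := fD i j x y; apply: le_trans (inf_family_le l _) hl.
- rewrite mulrC -ler_pdivrMr//;
  apply: (le_inf_family) => i; rewrite ler_pdivrMr// mulrC.
  by have [l hl] := fZ i t x t0; apply: le_trans (inf_family_le l _) hl.
Qed.

(** This is the largest sublinear functional below [p] whose value at [- v] is at
    most [- p v]: such a functional [g] satisfies
    [g x <= g (x + rs t *: v) + t * g (- v) <= p (x + rs t *: v) - t * p v]. *)
Definition tangent p v x : R :=
  inf [set p (x + rs t *: v) - t * p v | t in [set t | 0 < t]].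

(** Positive homogeneity holds only because all [t] compete in the infimum:
    scaling [x] by [a] turns the member of index [t] at [x] into the member of
    index [a * t] at [rs a *: x]. *)
Lemma tangent_sublinear p v : sublinear p ->
  [/\ sublinear (tangent p v), forall x, tangent p v x <= p x &
      forall x, tangent p v x <= p (x + v) - p v].
Proof.
move=> hp.
pose f (t : {t : R | 0 < t}) x := p (x + rs (sval t) *: v) - sval t * p v.
have e x : tangent p v x = inf (range (f^~ x)).
  rewrite /tangent; congr inf; rewrite predeqE => y; split.
    by move=> [t /= t0 <-]; exists (exist _ t t0).
  by move=> [[t t0] _ <-]; exists t.
have one : 0 < (1 : R) by [].
have [] := @inf_sublinear _ (exist _ 1 one) f.
- move=> [s s0] [t t0] x y; exists (exist _ (s + t) (addr_gt0 s0 t0)).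
  rewrite /f /=.
  have := hp.1 (x + rs s *: v) (y + rs t *: v).
  by rewrite addrACA -scalerDl -real_scalarD => h; lra.
- move=> [s s0] t x t0; exists (exist _ (t * s) (mulr_gt0 t0 s0)).
  rewrite /f /= real_scalarM -scalerA -scalerDr (sublinearZ _ hp t0).
  by rewrite mulrBr mulrA.
- move=> x; exists (- p (- x)) => -[t t0]; rewrite /f /= -(sublinearZ _ hp t0).
  have := hp.1 (x + rs t *: v) (- x).
  by rewrite addrAC subrr add0r => h; lra.
move=> hs hle; have -> : tangent p v = fun x => inf (range (f^~ x)).
  by apply/funext.
split=> // x; last first.
  apply: le_trans (hle (exist _ 1 one) x) _.
  by rewrite /f /= real_scalar1 scale1r mul1r.
apply: le_trans (hle (exist _ 1 one) x) _; rewrite /f /= real_scalar1 scale1r mul1r.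
have := hp.1 x v; lra.
Qed.

(** A minimal sublinear functional [u] coincides with [tangent u y] for every
    [y], whence [u x <= u (x + y) - u y] and [u] is additive; Zorn's lemma
    provides a minimal one below any given one. *)
Lemma exists_linear_below p : sublinear p ->
  exists2 u, real_linear u & forall x, u x <= p x.
Proof.
move=> hp.
pose P q := sublinear q /\ forall x, q x <= p x.
pose T := {q : V -> R | P q}.
pose le_T (r s : T) := `[< forall x, sval s x <= sval r x >].
have p0 : T by exists p.
have [| | |[u [hu up]] umin] := @ZL_preorder T p0 le_T.
- by move=> r; apply/asboolP.
- move=> r s t /asboolP rs' /asboolP st; apply/asboolP => x.
  exact: le_trans (st x) (rs' x).
- move=> A Atot; have [[a0 Aa0]|A0] := pselect (exists a, A a); last first.
    by exists p0 => s As; case: A0; exists s.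
  pose f (a : {a : T | A a}) := sval (sval a).
  have fs a : sublinear (f a) by exact: (svalP (sval a)).1.
  have [| | |gs gle] := @inf_sublinear _ (exist _ a0 Aa0) f.
  + move=> a b x y; case: (Atot _ _ (svalP a) (svalP b)) => /asboolP ab.
      by exists b; apply: le_trans ((fs b).1 _ _) _; rewrite lerD2r ab.
    by exists a; apply: le_trans ((fs a).1 _ _) _; rewrite lerD2l ab.
  + by move=> a t x t0; exists a; exact: (fs a).2.
  + move=> x; exists (- p (- x)) => a; apply: le_trans (sublinear_ge _ (fs a)).
    by rewrite lerN2; exact: (svalP (sval a)).2.
  have gp x : inf (range (f^~ x)) <= p x.
    apply: le_trans (gle (exist _ a0 Aa0) x) _; exact: (svalP a0).2.
  exists (exist P _ (conj gs gp)) => s As; apply/asboolP => x /=.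
  exact: (gle (exist _ s As) x).
have uD x y : u (x + y) = u x + u y.
  apply/eqP; rewrite eq_le hu.1 /=.
  have [ts tle tv] := tangent_sublinear y hu.
  have tp z : tangent u y z <= p z by exact: le_trans (tle z) (up z).
  have /asboolP/(_ x)/= := umin (exist P _ (conj ts tp)) (asboolT tle).
  by have := tv x; lra.
exists u => //; split=> // t x.
have uN z : u (- z) = - u z.
  by have := uD z (- z); rewrite subrr (sublinear0 hu) => h; lra.
have [t0|t0|->] := ltrgt0P t; first exact: sublinearZ.
  rewrite -[t]opprK; set s := - t; have s0 : 0 < s by rewrite oppr_gt0.
  have -> : rs (- s) = - rs s.
    by apply/eqP; rewrite -addr_eq0 -real_scalarD addNr real_scalar0.
  by rewrite scaleNr uN (sublinearZ _ hu s0) -mulNr.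
by rewrite real_scalar0 scale0r mul0r sublinear0.
Qed.

End Sublinear.

(** A linear functional below the tangent of the norm towards [s] lies below
    the norm and takes at [- s] a value that is at most [- rnorm s]; bounded by
    the norm, it must then be equal to [rnorm s] at [s]. *)
Lemma norming_functional (F : normedModType K) (s : F) :
  exists2 u : F -> R, real_linear u &
    (forall x, `|u x| <= rnorm x) /\ u s = rnorm s.
Proof.
have hn : sublinear (@rnorm R k F).
  split=> [x y|t x t0]; first exact: rnormD.
  by rewrite rnormZ rnorm_real_scalar gtr0_norm.
have [ts tle tv] := tangent_sublinear s hn.
have [u ul ut] := exists_linear_below ts.
have un x : u x <= rnorm x by exact: le_trans (ut x) (tle x).
have uN x : u (- x) = - u x.
  have /eqP := ul.1 x (- x); have /eqP := ul.1 0 0.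
  by rewrite addr0 subrr => /eqP a /eqP b; lra.
exists u => //; split.
  by move=> x; rewrite ler_norml un andbT lerNl -uN -rnormN.
apply/eqP; rewrite eq_le un /=.
by have := le_trans (ut (- s)) (tv (- s)); rewrite uN addNr rnorm0; lra.
Qed.

End HahnBanach.

(** * Uniform boundedness *)

Section UniformBoundedness.
Variable R : realType.

(** From [d n.+1 <= d n / 2] follows [n.+1 * d n <= d 0], so that the archimedean
    property provides [n]. *)
Lemma halving_small (d : nat -> R) : (forall n, 0 <= d n) ->
  (forall n, d n.+1 <= d n / 2) ->
  forall c e, 0 < e -> exists n, c * d n < e.
Proof.
move=> d0 dS c e e0.
have dn n : n.+1%:R * d n <= d 0.
  elim: n => [|n IH]; first by rewrite mul1r.
  apply: le_trans IH; rewrite -(natr1 n.+1) -(natr1 n).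
  have := dS n; have := d0 n; have := ler0n R n; nra.
have [n hn] : exists n : nat, `|c| * d 0 / e < n.+1%:R.
  exists (Num.truncn (`|c| * d 0 / e)).
  by have /andP[] := truncn_itv (divr_ge0 (mulr_ge0 (normr_ge0 c) (d0 0)) (ltW e0)).
exists n; apply: le_lt_trans (ler_wpM2r (d0 n) (ler_norm c)) _.
have n0 : 0 < n.+1%:R :> R by [].
rewrite -(ltr_pM2l n0) mulrCA.
apply: le_lt_trans (ler_wpM2l (normr_ge0 c) (dn n)) _.
by rewrite -ltr_pdivrMr.
Qed.

Lemma eq0_of_halving (d : nat -> R) (c a : R) : (forall n, 0 <= d n) ->
  (forall n, d n.+1 <= d n / 2) -> (forall n, `|a| <= c * d n) -> a = 0.
Proof.
move=> d0 dS ha; apply/eqP; rewrite -normr_le0; apply/ler_addgt0Pr => e e0.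
have [n hn] := halving_small d0 dS c e0.
by rewrite add0r (le_trans (ha n)) ?ltW.
Qed.

(** The gliding hump argument. [B d v] reads as: [v] is admissible and of norm
    at most [d]; keeping the norm relational lets one statement cover a Banach
    space and the dual of a normed space. If the family [p] were unbounded on
    every ball, one could add up vectors [v n] of rapidly decreasing norms such
    that some [p i] is large at the [n]-th partial sum, while the later terms
    are too small for that [p i] to notice, given its continuity constant; the
    sum of the series then contradicts the pointwise bound. *)
Lemma uniform_boundedness (V : zmodType) (I : Type) (B : R -> V -> Prop)
    (p : I -> V -> R) :
    B 0 0 ->
    (forall d e u v, B d u -> B e v -> B (d + e) (u + v)) ->
    (forall (v : nat -> V) (d : nat -> R), (forall n, 0 <= d n) ->
       (forall n, d n.+1 <= d n / 2) -> (forall n, B (d n) (v n)) ->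
       exists l, forall n, B (2 * d n) (l - \sum_(i < n) v i)) ->
    (forall i u v, p i (u - v) <= p i u + p i v) ->
    (forall i, exists2 c, 0 < c & forall d v, 0 <= d -> B d v -> p i v <= c * d) ->
    (forall d v, B d v -> exists M, forall i, p i v <= M) ->
  exists d M, 0 < d /\ forall i v, B d v -> p i v <= M.
Proof.
move=> B0 BD Bcomplete pB pcont pbnd; apply: contrapT => unbnd.
have pick d M : 0 < d -> exists i v, B d v /\ M < p i v.
  move=> d0; apply: contrapT => h; apply: unbnd; exists d, M; split=> // i v Bv.
  by rewrite leNgt; apply/negP => pM; apply: h; exists i, v.
have [i0 [v0 _]] := pick 1 0 ltr01.
have /choice[S hS] (dM : R * R) : exists iv : I * V,
    0 < dM.1 -> B dM.1 iv.2 /\ dM.2 < p iv.1 iv.2.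
  have [d0|d0] := ltP 0 dM.1; last by exists (i0, v0).
  by have [i [v h]] := pick dM.1 dM.2 d0; exists (i, v).
have /choice[c hc] (i : I) :
    exists c, 0 < c /\ forall d v, 0 <= d -> B d v -> p i v <= c * d.
  by have [c c0 h] := pcont i; exists c.
have /choice[m hm] (v : V) : exists m, forall d, B d v -> forall i, p i v <= m.
  have [[d Bd]|h] := pselect (exists d, B d v).
    by have [m hm] := pbnd d v Bd; exists m.
  by exists 0 => d Bd; case: h; exists d.
(* The state after [n] steps: the radius for the next vector, and the partial
   sum. The threshold [n.+1 + m x] absorbs whatever [p i] does at the current
   partial sum [x]. *)
pose next n (s : R * V) := S (s.1, n.+1%:R + m s.2).
pose step n (s : R * V) : R * V :=
  (Num.min (s.1 / 2) (2 * c (next n s).1)^-1, s.2 + (next n s).2).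
pose st := fix st n := if n is n'.+1 then step n' (st n') else (1, 0).
pose d n := (st n).1; pose v n := (next n (st n)).2.
pose i n := (next n (st n)).1.
have d_gt0 n : 0 < d n.
  elim: n => [|n IH] //; rewrite /d /= lt_min divr_gt0//= invr_gt0 mulr_gt0//.
  exact: (hc _).1.
have dS n : d n.+1 <= d n / 2 by rewrite /d /= ge_min lexx.
have dc n : c (i n) * (2 * d n.+1) <= 1.
  have c0 := (hc (i n)).1; rewrite mulrCA mulrA -ler_pdivlMl ?mulr_gt0// mulr1.
  by rewrite /d /= ge_min lexx orbT.
have x_sum n : (st n).2 = \sum_(j < n) v j.
  by elim: n => [|n IH]; rewrite ?big_ord0// big_ord_recr /= -IH.
have vB n : B (d n) (v n) /\ n.+1%:R + m (st n).2 < p (i n) (v n).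
  exact: (hS (d n, n.+1%:R + m (st n).2) (d_gt0 n)).
have x_B n : exists e, B e (st n).2.
  elim: n => [|n [e Be]]; first by exists 0.
  by exists (e + d n); apply: BD => //; exact: (vB n).1.
have [l hl] := Bcomplete v d (fun n => ltW (d_gt0 n)) dS (fun n => (vB n).1).
have l_le j : p j l <= m l.
  by have := hl 0; rewrite big_ord0 subr0 => /hm.
have n_lt n : n%:R < m l.
  have [e Be] := x_B n.
  have v_le : p (i n) (v n) <= p (i n) (st n.+1).2 + m (st n).2.
    have -> : v n = (st n.+1).2 - (st n).2 by rewrite /= addrAC subrr add0r.
    by apply: le_trans (pB _ _ _) _; rewrite lerD2l; exact: hm Be _.
  have x_le : p (i n) (st n.+1).2 <= m l + 1.
    rewrite -[(st n.+1).2](subKr l); apply: le_trans (pB _ _ _) _.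
    apply: lerD => //; apply: le_trans (dc n).
    by apply: (hc _).2; rewrite ?x_sum ?mulr_ge0 ?ltW//; exact: hl.
  by have := (vB n).2; rewrite -natr1; lra.
have := n_lt (Num.truncn (m l)).+1; apply/negP; rewrite -leNgt ltW//.
have m0 : 0 <= m l by have := n_lt 0; exact: ltW.
by have /andP[] := truncn_itv m0.
Qed.

End UniformBoundedness.

Section Banach.
Variables (R : realType) (k : scalar_kind).
Local Notation K := (scalars R k).
Local Notation rs := (@real_scalar R k).

(** The factor 2 is the sum of the geometric series of ratio one half, which
    dominates the tail of the series after its first [n] terms. *)
Lemma halving_series_cvg (E : completeNormedModType K) (v : nat -> E)
    (d : nat -> R) :
    (forall n, 0 <= d n) -> (forall n, d n.+1 <= d n / 2) ->
    (forall n, rnorm (v n) <= d n) ->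
  exists l, forall n, rnorm (l - \sum_(i < n) v i) <= 2 * d n.
Proof.
move=> d0 dS vd; pose X n := \sum_(i < n) v i.
have XS n : X n.+1 = X n + v n by rewrite /X big_ord_recr.
have tail j n : rnorm (X (n + j)%N - X n) <= 2 * d n.
  elim: j n => [|j IH] n; first by rewrite addn0 subrr rnorm0 mulr_ge0.
  have -> : X (n + j.+1)%N - X n = v n + (X (n.+1 + j)%N - X n.+1).
    by rewrite addSnnS XS opprD addrCA [v n + _]addrCA subrr addr0.
  apply: le_trans (rnormD _ _) _.
  by have := vd n; have := dS n; have := IH n.+1; lra.
have cvX : cvgn X.
  apply: cauchy_cvg; apply: cauchy_exP => e e0.
  have re0 : 0 < re e.
    by rewrite -(ltr_real_scalar k) -real_scalar_re ?real_scalar0// ltW.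
  have [n hn] := halving_small d0 dS 2 re0.
  exists (X n); exists n => // j /= nj.
  rewrite -ball_normE /= (real_scalar_re (ltW e0)) norm_rnorm ltr_real_scalar.
  by apply: le_lt_trans hn; rewrite -rnormN opprB -(subnKC nj); exact: tail.
exists (limn X) => n; apply/ler_addgt0Pr => e e0.
have e0' : 0 < rs e by rewrite -(real_scalar0 R k) ltr_real_scalar.
have /cvgrPdist_lt/(_ _ e0')[j _ hj] := cvX.
have := hj (n + j)%N (leq_addl _ _).
rewrite /= norm_rnorm ltr_real_scalar => lj.
rewrite -(subrK (X (n + j)%N) (limn X)) -addrA addrC.
by apply: le_trans (rnormD _ _) _; rewrite lerD// ltW.
Qed.

End Banach.

Section Duality.
Variables (R : realType) (k : scalar_kind).
Local Notation K := (scalars R k).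
Local Notation rs := (@real_scalar R k).

Lemma real_linear0 (V : lmodType K) (u : V -> R) : real_linear u -> u 0 = 0.
Proof. by move=> [uD _]; have := uD 0 0; rewrite addr0; lra. Qed.

Lemma real_linearN (V : lmodType K) (u : V -> R) x :
  real_linear u -> u (- x) = - u x.
Proof.
by move=> ul; have := ul.1 x (- x); rewrite subrr (real_linear0 ul); lra.
Qed.

(** Uniform boundedness for evaluations on the dual: the dual of a normed space
    is complete, and by [norming_functional] the norm of [s] is the supremum of
    the values at [s] of the functionals of norm at most one. *)
Lemma weakly_bounded_bounded (F : normedModType K) (A : set F) :
    (forall u (M : R), real_linear u -> (forall x, `|u x| <= M * rnorm x) ->
       exists N, forall s, A s -> `|u s| <= N) ->
  exists M, forall s, A s -> rnorm s <= M.
Proof.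
move=> wA.
pose B (d : R) (u : F -> R) :=
  real_linear u /\ forall x, `|u x| <= d * rnorm x.
pose p (s : {s | A s}) (u : F -> R) := `|u (sval s)|.
have [d [M [d0 hM]]] : exists d M, 0 < d /\ forall s u, B d u -> p s u <= M.
  apply: (@uniform_boundedness R (F -> R) _ B p).
  - split; last by move=> x; rewrite mul0r normr0.
    by split=> [x y|t x]; rewrite /= ?addr0 ?mulr0.
  - move=> d e u v [[uD uZ] ud] [[vD vZ] ve]; split.
      by split=> [x y|t x]; rewrite !fctE ?uD ?vD ?uZ ?vZ; ring.
    move=> x /=; apply: le_trans (ler_normD _ _) _.
    by rewrite mulrDl lerD.
  - move=> v d d0 dS vd.
    have /choice[l hl] (x : F) : exists l : R, forall n,
        `|l - \sum_(i < n) v i x| <= 2 * (d n * rnorm x).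
      apply: (@halving_series_cvg R RealScalars R^o (fun n => v n x)
        (fun n => d n * rnorm x)).
      + by move=> n; rewrite mulr_ge0 ?rnorm_ge0.
      + by move=> n; rewrite mulrAC ler_wpM2r ?rnorm_ge0.
      + by move=> n; exact: (vd n).2.
    have sumD n x y : \sum_(i < n) v i (x + y) =
        \sum_(i < n) v i x + \sum_(i < n) v i y.
      by rewrite -big_split; apply: eq_bigr => i _; exact: (vd i).1.1.
    have sumZ n t x : \sum_(i < n) v i (rs t *: x) = t * \sum_(i < n) v i x.
      by rewrite big_distrr; apply: eq_bigr => i _; exact: (vd i).1.2.
    (* The bound [hl] determines [l x], and linearity passes to the limit. *)
    have llin : real_linear l.
      split=> [x y|t x]; apply/eqP; rewrite -subr_eq0; apply/eqP.
        apply: (eq0_of_halving d0 dS (c := 2 * (rnorm (x + y) + rnorm x + rnorm y))).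
        move=> n; have := hl (x + y) n; have := hl x n; have := hl y n.
        rewrite sumD !ler_norml; lra.
      apply: (eq0_of_halving d0 dS (c := 2 * (rnorm (rs t *: x) + `|t| * rnorm x))).
      move=> n; have := hl (rs t *: x) n.
      have : `|t * (l x - \sum_(i < n) v i x)| <= `|t| * (2 * (d n * rnorm x)).
        by rewrite normrM ler_wpM2l.
      rewrite sumZ mulrBr !ler_norml; lra.
    exists l => n.
    have lE x : (l - \sum_(i < n) v i) x = l x - \sum_(i < n) v i x.
      by rewrite !fctE fct_sumE.
    split; last by move=> x; rewrite lE -mulrA.
    by split=> [x y|t x]; rewrite !lE ?sumD ?sumZ ?llin.1 ?llin.2; ring.
  - by move=> s u v; rewrite /p /=; exact: ler_normB.
  - move=> s; exists (1 + rnorm (sval s)).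
      by rewrite ltr_pwDl ?rnorm_ge0.
    move=> d v d0 [_ vd]; apply: le_trans (vd _) _.
    by rewrite mulrDl mul1r mulrC lerDr.
  - move=> d u [ul ud]; have [N hN] := wA u d ul ud.
    by exists N => -[s As]; exact: hN.
exists (M / d) => s As.
have [u ul [un us]] := norming_functional s.
rewrite ler_pdivlMr// mulrC.
have -> : d * rnorm s = p (exist _ s As) (fun x => d * u x).
  by rewrite /p /= us ger0_norm// mulr_ge0 ?rnorm_ge0// ltW.
apply: hM; split; first split=> [x y|t x].
- by rewrite ul.1 mulrDr.
- by rewrite ul.2 mulrCA.
- by move=> x; rewrite normrM gtr0_norm// ler_wpM2l// ltW.
Qed.

End Duality.

(** * Summability criteria and complexification *)

Section Summability.
Variables (R : realType) (k : scalar_kind).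
Local Notation K := (scalars R k).

Lemma lpP (E : normedModType K) (p : R) (x : nat -> E) :
  lp p x <-> exists M, forall N, \sum_(j < N) rnorm (x j) `^ p <= M.
Proof.
have x0 n : (0 <= n)%N -> true -> (0 <= (rnorm (x n) `^ p)%:E)%E.
  by rewrite lee_fin powR_ge0.
split=> [xfin|[M hM]].
  exists (fine (\sum_(0 <= j <oo) (rnorm (x j) `^ p)%:E)%E) => N.
  rewrite -lee_fin fineK; last first.
    by rewrite ge0_fin_numE//; apply: nneseries_ge0.
  rewrite -sumEFin -(big_mkord xpredT (fun j => (rnorm (x j) `^ p)%:E)).
  exact: nneseries_lim_ge.
apply: (@le_lt_trans _ _ M%:E); last exact: ltry.
apply: lime_le; first exact: is_cvg_nneseries.
apply: nearW => N; rewrite big_mkord sumEFin lee_fin; exact: hM.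
Qed.

Lemma lp1P (E : normedModType K) (x : nat -> E) :
  lp 1 x <-> exists M, forall N, \sum_(j < N) rnorm (x j) <= M.
Proof.
have e N : \sum_(j < N) rnorm (x j) `^ 1 = \sum_(j < N) rnorm (x j).
  by apply: eq_bigr => j _; rewrite powRr1// rnorm_ge0.
split=> [/lpP[M hM]|[M hM]]; first by exists M => N; rewrite -e.
by apply/lpP; exists M => N; rewrite e.
Qed.

Lemma linear_structure (E F : lmodType K) (f : E -> F) :
  linear f -> exists g : {linear E -> F}, f = g.
Proof.
move=> lf.
pose g : {linear E -> F} := HB.pack f (GRing.isLinear.Build _ _ _ _ _ lf).
by exists g.
Qed.

End Summability.

(** Over the complex numbers a real functional [u] is the real part of the
    complex functional [fun x => u x - 'i * u ('i *: x)]. *)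
Lemma extend_real_functional (R : realType) (k : scalar_kind)
    (F : normedModType (scalars R k)) (u : F -> R) (M : R) :
    real_linear u -> (forall x, `|u x| <= M * rnorm x) ->
  exists2 phi : F -> (scalars R k)^o, bounded_functional phi &
    forall x, `|u x| <= rnorm (phi x).
Proof.
case: k F u => F u [uD uZ] uM.
  exists u => //; split; last by exists M.
  by move=> a x y; rewrite uD uZ.
pose phi x : (complex R)^o := Complex (u x) (- u ('i%C *: x)).
have rsE (a b : R) : Complex a b =
    @real_scalar R ComplexScalars a + @real_scalar R ComplexScalars b * 'i%C.
  by apply/eqP; rewrite eq_complex /= !mul0r !mulr0 !mulr1 subr0 !addr0 add0r !eqxx.
have uC (a b : R) x : u (Complex a b *: x) = a * u x + b * u ('i%C *: x).
  by rewrite rsE scalerDl -scalerA uD !uZ.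
exists phi; first split.
- move=> [a b] x y; apply/eqP; rewrite eq_complex /phi /=.
  rewrite scalerDr !uD scalerA.
  have -> : 'i%C * Complex a b = Complex (- b) a.
    by apply/eqP; rewrite eq_complex /= !mul0r !mul1r sub0r add0r !eqxx.
  rewrite (uC a b) (uC (- b) a); apply/andP; split; apply/eqP; ring.
- exists (M + M) => x.
  have i1 : @rnorm R ComplexScalars (complex R)^o 'i%C = 1.
    by rewrite /rnorm /re normc_def /= expr0n expr1n add0r sqrtr1.
  have iM := uM ('i%C *: x); rewrite rnormZ i1 mul1r in iM.
  have -> : phi x = (@real_scalar R ComplexScalars (u x) : (complex R)^o) +
      'i%C *: (@real_scalar R ComplexScalars (- u ('i%C *: x)) : (complex R)^o).
    by rewrite /phi rsE; congr (_ + _); rewrite mulrC.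
  apply: le_trans (rnormD _ _) _; rewrite rnormZ i1 mul1r !rnorm_real_scalar normrN.
  by rewrite mulrDl lerD.
- move=> x; exact: (@norm_re_le R ComplexScalars (phi x)).
Qed.

(** * Weakly summable sequences and random signs *)

Section Signs.
Variables (R : realType) (k : scalar_kind).
Local Notation K := (scalars R k).

(** A real functional [u] is bounded on all these sums by the sum of the
    [`|u (y j)|], so they form a weakly bounded set. The coefficient zero is
    allowed along with the signs because the Rademacher functions vanish at some
    dyadic points. *)
Lemma weak_l1_signed_sums (F : normedModType K) (y : nat -> F) :
    weak_lp 1 y ->
  exists M, forall N (e : nat -> int), (forall j, `|e j| <= 1) ->
    rnorm (\sum_(j < N) y j *~ e j) <= M.
Proof.
move=> wy.
pose A := [set s : F | exists N (e : nat -> int), (forall j, `|e j| <= 1) /\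
  s = \sum_(j < N) y j *~ e j].
have [u M ul uM|M hM] := @weakly_bounded_bounded R k F A; last first.
  by exists M => N e he; apply: hM; exists N, e.
have [phi phib uphi] := extend_real_functional ul uM.
have /lp1P[D hD] := wy phi phib.
exists D => _ [N [e [he ->]]].
have u_sum : `|u (\sum_(j < N) y j *~ e j)| <= \sum_(j < N) `|u (y j)|.
  elim/big_rec2: _ => [|j a s _ IH]; first by rewrite (real_linear0 ul) normr0.
  rewrite ul.1; apply: le_trans (ler_normD _ _) _; apply: lerD => //.
  have : e j = 0 \/ e j = 1 \/ e j = -1 by have := he j; lia.
  by case=> [->|[->|->]]; rewrite ?mulr0z ?mulr1z ?mulrN1z
    ?(real_linear0 ul) ?normr0// (real_linearN _ ul) normrN.
by apply: le_trans (hD N); apply: le_trans u_sum _; apply: ler_sum.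
Qed.

(** Averaging over all signs isolates the diagonal: keeping the [j]-th sign and
    changing all the others pairs [x j + v] with [x j - v], whose [p j]-values
    add up to at least [2 * p j (x j)]. *)
Lemma diagonal_le_signed_sums (E : zmodType) (N : nat) (p : 'I_N -> E -> R)
    (x : 'I_N -> E) (D : R) :
    (forall j u, p j (- u) = p j u) ->
    (forall j u v, 2 * p j u <= p j (u + v) + p j (u - v)) ->
    (forall e : {ffun 'I_N -> bool},
       \sum_j p j (\sum_l (if e l then - x l else x l)) <= D) ->
  \sum_j p j (x j) <= D.
Proof.
move=> pN pD hD; pose T := {ffun 'I_N -> bool}.
pose S (e : T) := \sum_l (if e l then - x l else x l).
have T0 : 0 < #|T|%:R :> R by rewrite ltr0n; apply/card_gt0P; exists [ffun=> true].
have diag j : #|T|%:R * p j (x j) <= \sum_e p j (S e).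
  pose flip (e : T) : T := [ffun l => if l == j then e l else ~~ e l].
  have flipK : involutive flip.
    by move=> e; apply/ffunP => l; rewrite !ffunE; case: eqP => // _; rewrite negbK.
  have flipS : \sum_e p j (S e) = \sum_e p j (S (flip e)).
    by rewrite (reindex_inj (inv_inj flipK)).
  have pair e : 2 * p j (x j) <= p j (S e) + p j (S (flip e)).
    pose v := \sum_(l | l != j) (if e l then - x l else x l).
    have -> : S e = (if e j then - x j else x j) + v by rewrite /S (bigD1 j).
    have -> : S (flip e) = (if e j then - x j else x j) - v.
      rewrite /S (bigD1 j)//= ffunE eqxx; congr (_ + _).
      rewrite /v -sumrN; apply: eq_bigr => l /negPf lj.
      by rewrite ffunE lj; case: (e l); rewrite ?opprK.
    by apply: le_trans (pD _ _ _); case: (e j); rewrite ?pN.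
  have : \sum_(e : T) 2 * p j (x j) <= \sum_e (p j (S e) + p j (S (flip e))).
    by apply: ler_sum => e _; exact: pair.
  by rewrite big_split /= -flipS sumr_const -mulr_natl; lra.
rewrite -(ler_pM2l T0) big_distrr /=.
apply: le_trans (ler_sum _ (fun j _ => diag j)) _.
rewrite exchange_big /=; apply: le_trans (ler_sum _ (fun e _ => hD e)) _.
by rewrite sumr_const mulr_natl lexx.
Qed.

(** By uniform boundedness the sums of [rnorm (b j z)] are at most a constant times
    [rnorm z]; this is applied to the signed sums [z] of the sequence [x], which
    are bounded, and [diagonal_le_signed_sums] returns to the terms
    [b j (x j)]. *)
Lemma lp1_functionals_weak_l1 (E : completeNormedModType K)
    (b : nat -> E -> K^o) (x : nat -> E) :
    (forall j, bounded_functional (b j)) -> (forall z, lp 1 (b^~ z)) ->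
    weak_lp 1 x ->
  lp 1 (fun j => b j (x j)).
Proof.
move=> bb bz wx.
have blin j : exists g : {linear E -> K^o}, b j = g.
  exact: linear_structure (bb j).1.
have bD j u v : b j (u + v) = b j u + b j v.
  by have [g ->] := blin j; rewrite linearD.
have bN j u : b j (- u) = - b j u by have [g ->] := blin j; rewrite linearN.
have bZ j a u : b j (a *: u) = a *: b j u.
  by have [g ->] := blin j; rewrite linearZ.
pose p N z := \sum_(j < N) rnorm (b j z).
have [d [C [d0 hC]]] : exists d C, 0 < d /\
    forall N z, rnorm z <= d -> p N z <= C.
  apply: (@uniform_boundedness R E nat (fun d z => rnorm z <= d) p).
  - by rewrite rnorm0.
  - by move=> d e u v ud ve; apply: le_trans (rnormD _ _) _; exact: lerD.
  - exact: halving_series_cvg.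
  - move=> N u v; rewrite /p -big_split; apply: ler_sum => j _.
    by rewrite bD bN rnormB.
  - move=> N; have /choice[c hc] j :
        exists c, forall z, rnorm (b j z) <= c * rnorm z.
      by have [_ [c hc]] := bb j; exists c.
    exists (1 + \sum_(j < N) `|c j|).
      by rewrite ltr_pwDl ?sumr_ge0.
    move=> d z d0 zd; rewrite mulrDl mul1r big_distrl /=.
    apply: ler_wpDl => //; apply: ler_sum => j _.
    apply: le_trans (hc j z) _; apply: le_trans (_ : `|c j| * rnorm z <= _).
      by rewrite ler_wpM2r ?rnorm_ge0 ?ler_norm.
    exact: ler_wpM2l.
  - by move=> _ z _; have /lp1P[M hM] := bz z; exists M.
have [M hM] := weak_l1_signed_sums wx.
have M0 : 0 <= M.
  by have := hM 0 (fun=> 0) (fun=> ler01); rewrite big_ord0 rnorm0.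
have C1 : 0 < M + 1 by lra.
(* Multiplication by [t] brings the signed sums, bounded by [M], into the ball of
   radius [d]; the denominator [M + 1] cannot vanish. *)
pose t := d / (M + 1); have t0 : 0 < t by rewrite divr_gt0.
have tM z : rnorm z <= M -> rnorm (real_scalar k t *: z) <= d.
  move=> zM; rewrite rnormZ rnorm_real_scalar gtr0_norm//.
  rewrite /t -mulrA ger_pMr// mulrC ler_pdivrMr// mul1r; lra.
apply/lp1P; exists (C / t) => N.
apply: (@diagonal_le_signed_sums E N (fun j u => rnorm (b j u)) (fun j => x j)).
- by move=> j u; rewrite bN rnormN.
- move=> j u v; have := rnormD (b j (u + v)) (b j (u - v)).
  have -> : b j (u + v) + b j (u - v) = real_scalar k 2 *: b j u.
    rewrite !bD bN addrACA subrr addr0 -[2]/(1 + 1) real_scalarD.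
    by rewrite scalerDl real_scalar1 !scale1r.
  by rewrite rnormZ rnorm_real_scalar ger0_norm.
move=> e.
(* The bound [hM] is about coefficients that form a sequence of integers. *)
pose s j : int := if insub j is Some l then (if e l then -1 else 1) else 0.
have -> : \sum_l (if e l then - x l else x l) = \sum_(l < N) x l *~ s l.
  apply: eq_bigr => l _; rewrite /s; case: insubP => [l' _ ll'|]; last first.
    by rewrite ltn_ord.
  by rewrite (val_inj ll'); case: (e l); rewrite ?mulrN1z ?mulr1z.
set z := \sum_(l < N) _.
have zM : rnorm z <= M.
  by apply: hM => j; rewrite /s; case: insub => // l; case: (e l).
rewrite ler_pdivlMr// mulrC big_distrr /=.
have -> : \sum_(j < N) t * rnorm (b j z) = p N (real_scalar k t *: z).
  by apply: eq_bigr => j _; rewrite bZ rnormZ rnorm_real_scalar gtr0_norm.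
exact/hC/tM.
Qed.

End Signs.

(** * Composing and modifying families of vectors *)

Section Tuples.
Variables (s m : nat) (E : 'I_(s + m) -> Type).

(** The equation carried by [SplitOrdLo] transports [x j] from the type
    [E (lshift m j)] to the type [E i]. *)
Definition glue (x : forall j : 'I_s, E (lshift m j)) (z : forall i, E i) i : E i :=
  match split_ordP i with
  | SplitOrdLo j e => eq_rect_r E (x j) e
  | SplitOrdHi _ _ => z i
  end.

Lemma glue_lshift x z j : glue x z (lshift m j) = x j.
Proof.
rewrite /glue; case: split_ordP => [j' e|j' e]; last first.
  by have /eqP := e; rewrite eq_shift.
by have ej := lshift_inj e; subst j'; rewrite (eq_irrelevance e erefl).
Qed.

Lemma glue_rshift x z j : glue x z (rshift s j) = z (rshift s j).
Proof.
by rewrite /glue; case: split_ordP => // j' e; have /eqP := e; rewrite eq_shift.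
Qed.

Lemma glue_dfwith x z j u :
  glue (dfwith x j u) z = dfwith (glue x z) (lshift m j) u.
Proof.
apply: functional_extensionality_dep => i; case: (split_ordP i) => l ->.
  rewrite glue_lshift; have [<-|jl] := eqVneq j l; first by rewrite !dfwithin.
  by rewrite !dfwithout ?glue_lshift ?(inj_eq (@lshift_inj _ _)).
by rewrite glue_rshift dfwithout ?glue_rshift ?eq_shift.
Qed.

End Tuples.

Section Mix.
Variables (n : nat) (E : 'I_n -> Type).
Implicit Types (x : forall i, nat -> E i) (z : forall i, E i).

Definition mix k x z j i : E i := if (i < k)%N then x i j else z i.

Lemma mixS k (kn : (k < n)%N) x z j :
  mix k.+1 x z j = dfwith (mix k x z j) (Ordinal kn) (x (Ordinal kn) j).
Proof.
apply: functional_extensionality_dep => i.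
have [<-|ki] := eqVneq (Ordinal kn) i; first by rewrite dfwithin /mix /= ltnSn.
rewrite dfwithout// /mix ltnS leq_eqVlt.
by case: eqP => // ik; case/eqP: ki; apply: val_inj.
Qed.

Lemma mix_dfwith k (kn : (k < n)%N) x z j u :
  mix k x (dfwith z (Ordinal kn) u) j = dfwith (mix k x z j) (Ordinal kn) u.
Proof.
apply: functional_extensionality_dep => i.
have [<-|ki] := eqVneq (Ordinal kn) i; first by rewrite dfwithin /mix ltnn dfwithin.
by rewrite dfwithout// /mix dfwithout.
Qed.

End Mix.

(** * From forms of [s] variables to forms of [s + m] variables *)

Section Extension.
Variables (R : realType) (k : scalar_kind) (s m : nat).
Local Notation K := (scalars R k).
Variable E : 'I_(s + m) -> completeNormedModType K.
Variable qs : 'I_s -> R.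
Local Notation Es := (fun i : 'I_s => E (lshift m i)).

Lemma bounded_multilinear_comp (F : normedModType K) (T : (forall i, E i) -> F)
    (phi : F -> K^o) :
  bounded_multilinear E F T -> bounded_functional phi ->
  bounded_multilinear E K^o (phi \o T).
Proof.
move=> [Tl [M hM]] [phil [C hC]].
have C1 : 0 < 1 + `|C| by rewrite ltr_pwDl.
split=> [x i a u v|]; first by rewrite /= Tl phil.
exists ((1 + `|C|) * M) => x /=; apply: le_trans (hC _) _.
rewrite -mulrA; apply: le_trans (_ : (1 + `|C|) * rnorm (T x) <= _).
  by rewrite ler_wpM2r ?rnorm_ge0// (le_trans (ler_norm _))// lerDr.
by rewrite ler_pM2l.
Qed.

Lemma bounded_multilinear_glue (A : (forall i, E i) -> K^o) (z : forall i, E i) :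
  bounded_multilinear E K^o A ->
  bounded_multilinear Es K^o (fun x => A (glue x z)).
Proof.
move=> [Al [M hM]]; split=> [x j a u v|].
  by rewrite !(glue_dfwith (E := fun i => E i)); exact: Al.
exists (M * \prod_(j < m) rnorm (z (rshift s j))) => x.
apply: le_trans (hM _) _; rewrite big_split_ord /=.
rewrite (eq_bigr (fun j => rnorm (x j))) => [|j _]; last by rewrite glue_lshift.
rewrite [X in _ * (_ * X)](eq_bigr (fun j => rnorm (z (rshift s j)))) => [|j _].
  by rewrite mulrAC mulrA.
by rewrite glue_rshift.
Qed.

(** Fixed vectors are replaced by weakly summable sequences one variable at a
    time. With [mix c x z] the variables below [c] already run through the
    sequences; as functions of the variable [c] alone the terms are absolutely
    summable functionals, so [lp1_functionals_weak_l1] applies. *)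
Lemma forms_abs_summing (A : (forall i, E i) -> K^o) (x : forall i, nat -> E i) :
    bounded_multilinear Es K^o `<=` abs_summing Es K^o 1 qs ->
    bounded_multilinear E K^o A ->
    (forall i, weak_lp (pad_ones m qs i) (x i)) ->
  lp 1 (fun j => A (fun i => x i j)).
Proof.
move=> forms bA wx.
have wl i : weak_lp (qs i) (x (lshift m i)).
  by have := wx (lshift m i); rewrite /pad_ones (unsplitK (inl i)).
have wr i : weak_lp 1 (x (rshift s i)).
  by have := wx (rshift s i); rewrite /pad_ones (unsplitK (inr i)).
have step c : (c <= m)%N -> forall z, lp 1 (fun j => A (mix (s + c) x z j)).
  elim: c => [_ z|c IH cm z].
    have [_ /(_ (fun i => x (lshift m i)) wl)] :=
      forms _ (bounded_multilinear_glue z bA).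
    rewrite addn0; congr lp; apply/funext => j; congr A.
    apply: functional_extensionality_dep => i; case: (split_ordP i) => l ->.
      by rewrite glue_lshift /mix /= ltn_ord.
    by rewrite glue_rshift /mix /= ltnNge leq_addr.
  have kn : (s + c < s + m)%N by rewrite ltn_add2l.
  pose i := Ordinal kn.
  rewrite addnS; have -> : (fun j => A (mix (s + c).+1 x z j)) =
      (fun j => A (dfwith (mix (s + c) x z j) i (x i j))).
    by apply/funext => j; rewrite mixS.
  apply: (@lp1_functionals_weak_l1 R k (E i)
    (fun j u => A (dfwith (mix (s + c) x z j) i u)) (x i)).
  - move=> j; case: bA => Al [M hM]; split; first exact: Al.
    exists (M * \prod_(l | l != i) rnorm (mix (s + c) x z j l)) => u.
    apply: le_trans (hM _) _; rewrite (bigD1 i)//= dfwithin mulrCA mulrC.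
    rewrite (eq_bigr (fun l => rnorm (mix (s + c) x z j l)))// => l li.
    by rewrite dfwithout// eq_sym.
  - move=> u; have := IH (ltnW cm) (dfwith z i u).
    by congr lp; apply/funext => j; rewrite mix_dfwith.
  - have -> : i = rshift s (Ordinal cm) by apply: val_inj.
    exact: wr.
have := step m (leqnn m) (fun i => x i 0).
by congr lp; apply/funext => j; congr A; apply: functional_extensionality_dep => i;
  rewrite /mix ltn_ord.
Qed.

End Extension.

(** * Cotype *)

Section Cotype.
Variables (R : realType) (k : scalar_kind).
Local Notation K := (scalars R k).

(** The integral of a nonnegative function is the supremum of the integrals of the
    simple functions below it, so that it is monotone for arbitrary functions. *)
Lemma ge0_Rintegral01_le (f : R -> R) (c : R) : (forall t, 0 <= f t) ->
    (forall t, f t <= c) ->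
  \int[lebesgue_measure]_(t in `[0%R, 1%R]) f t <= c.
Proof.
move=> f0 fc; have c0 : 0 <= c := le_trans (f0 0) (fc 0).
pose mu : measure _ R := @lebesgue_measure R.
have ic : (\int[mu]_(t in `[0%R, 1%R]) c%:E = c%:E)%E.
  rewrite integral_cst//= lebesgue_measure_itv/= lte_fin ltr01.
  by rewrite oppr0 adde0 mule1.
have le_fc : (\int[mu]_(t in `[0%R, 1%R]) (f t)%:E <= c%:E)%E.
  rewrite -ic !ge0_integralE//; last by move=> t _; rewrite lee_fin.
  apply: le_ereal_sup => _ [h hf <-]; exists h => //= t.
  by apply: le_trans (hf t) _; apply: lee_restrict => ? _; rewrite lee_fin.
have i0 : (0 <= \int[mu]_(t in `[0%R, 1%R]) (f t)%:E)%E.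
  by apply: integral_ge0 => t _; rewrite lee_fin.
rewrite /Rintegral -lee_fin fineK// ge0_fin_numE//.
exact: le_lt_trans le_fc (ltry _).
Qed.

Lemma cot_ge2 (F : normedModType K) (q : R) : cot F = q%:E -> 2 <= q.
Proof.
move=> hq; rewrite -lee_fin -hq; apply/ereal_infP => _ [r [r2 _] <-].
by rewrite lee_fin.
Qed.

(** At every point the Rademacher sum in the cotype inequality is a signed sum,
    and the signed sums of a weakly summable sequence are bounded. *)
Lemma cotype_weak_l1 (F : normedModType K) (q : R) (y : nat -> F) :
  0 < q -> has_cotype F q -> weak_lp 1 y -> lp q y.
Proof.
move=> q0 [C C0 hC] wy; have [M hM] := weak_l1_signed_sums wy.
have M0 : 0 <= M.
  by have := hM 0 (fun=> 0) (fun=> ler01); rewrite big_ord0 rnorm0.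
apply/lpP; exists ((C * M) `^ q) => N.
set S := \sum_(j < N) _.
have S0 : 0 <= S by apply: sumr_ge0 => j _; exact: powR_ge0.
have -> : S = (S `^ q^-1) `^ q by rewrite -powRrM mulVf ?gt_eqF// powRr1.
apply: ge0_ler_powR; rewrite ?nnegrE ?powR_ge0 ?mulr_ge0 ?(ltW q0)//.
apply: le_trans (hC N (fun j => y j)) _; rewrite ler_wpM2l//.
rewrite -(ger0_norm M0) -sqrtr_sqr ler_wsqrtr//.
apply: ge0_Rintegral01_le => t; first exact: sqr_ge0.
rewrite lerXn2r ?nnegrE ?rnorm_ge0//.
by apply: (hM N (fun j => rademacher j.+1 t)) => j; rewrite normr_sgz; case: eqP.
Qed.

End Cotype.

(** * Summability of multilinear maps *)

Theorem corollary5 (R : realType) (k : scalar_kind) (s m : nat) (hs : (0 < s)%N)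
  (E : 'I_(s + m) -> completeNormedModType (scalars R k))
  (F : completeNormedModType (scalars R k))
  (q : R) (qs : 'I_s -> R) (hqs : forall i, 1 <= qs i)
  (hcot : cot F = q%:E) (hattained : has_cotype F q)
  (hforms :
     bounded_multilinear (fun i : 'I_s => E (lshift m i)) (scalars R k)^o =
     abs_summing (fun i : 'I_s => E (lshift m i)) (scalars R k)^o 1 qs) :
  bounded_multilinear E F = abs_summing E F q (pad_ones m qs).
Proof.
apply/seteqP; split=> [T bT|T []//]; split=> // x wx.
apply: cotype_weak_l1 => //; first by have := cot_ge2 hcot; lra.
move=> phi bphi; apply: (forms_abs_summing (A := phi \o T)) wx.
  by rewrite hforms.
exact: bounded_multilinear_comp.
Qed.
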